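(* Let $n\geq 5$ and suppose that $a^{T}x\leq a_{0}$ defines a facet of the symmetric traveling salesman polytope $Q^{n}_{T}$. Then the following are facet inequalities of $P^{n}_{\overline{\mathrm{TSD}}}$: (a) $\hat{a}^{T}(x\oplus y\oplus z)\leq a_{0}$, for $\hat{a}=a\oplus 0\oplus 0$ and $\hat{a}=0\oplus a\oplus 0$; (b) $z_{ij}\geq 0$ and $z_{ij}\leq 1$, for all $ij\in E(K_{n})$; (c) $x_{ij}+y_{ij}-z_{ij}\leq 1$, for all $ij\in E(K_{n})$.
   Context: $K_n$ is the complete graph with vertex set $V(K_n)=\{1,\ldots,n\}$ and edge set $E(K_n)$; the edge $\{i,j\}$ is written $ij$. $K_n[A]$ is the subgraph induced by $A\subseteq V(K_n)$, and $x(S)=\sum_{ij\in S}x_{ij}$ for $S\subseteq E(K_n)$. $\oplus$ denotes concatenation of vectors. The ($n$-city) symmetric traveling salesman polytope $Q^n_T\subseteq\mathbb{R}^{\binom n2}$ is the convex hull of all $x\in\{0,1\}^{E(K_n)}$ with $\sum_{j\neq i}x_{ij}=2$ for all $i\in V(K_n)$ and $x(E(K_n[A]))\leq|A|-1$ for all nonempty proper subsets $A\subset V(K_n)$. $P^{n}_{\overline{\mathrm{TSD}}}\subseteq\mathbb{R}^{3\binom n2}$ is the convex hull of all $x\oplus y\oplus z\in\{0,1\}^{3\binom{n}{2}}$ (with $x,y,z$ indexed by $E(K_n)$) such that $x$ and $y$ each satisfy these constraints and $x_{ij}+y_{ij}-z_{ij}\leq 1$ for all $ij\in E(K_n)$.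 The dimension of a nonempty polytope is the dimension of its affine hull. If $a^Tw\leq a_0$ is valid for a polytope $P$, the face it defines is $\{w\in P: a^Tw=a_0\}$; a facet of $P$ is a face of dimension $\dim P-1$, and an inequality defines a facet (is a facet inequality) if it is valid for $P$ and the face it defines is a facet. *)

(* Defs.v *)
From HB Require Import structures.
From mathcomp Require Export all_boot all_order all_algebra.

Set Implicit Arguments.
Unset Strict Implicit.
Unset Printing Implicit Defensive.

Import Order.TTheory GRing.Theory Num.Theory.

Local Open Scope ring_scope.

(* The regular module R^o gives [vec R I] its vector space structure over R. *)
Notation vec R I := {ffun I -> R^o}.

Section Polyhedra.

Variables (R : realFieldType) (I : finType).
Implicit Types (S P : vec R I -> Prop) (a x : vec R I).

Definition dot a x : R := \sum_(i : I) a i * x i.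

Definition conv_hull S x : Prop :=
  exists (k : nat) (p : 'I_k -> vec R I) (w : 'I_k -> R),
    [/\ forall i, S (p i), forall i, 0 <= w i, \sum_i w i = 1
      & x = \sum_i w i *: p i].

Definition aff_hull S x : Prop :=
  exists (k : nat) (p : 'I_k -> vec R I) (w : 'I_k -> R),
    [/\ forall i, S (p i), \sum_i w i = 1 & x = \sum_i w i *: p i].

(* The affine hull of P is the translate x0 + U of a d-dimensional linear
   subspace U.  In particular P is nonempty and d is unique. *)
Definition has_dim P (d : nat) : Prop :=
  exists (x0 : vec R I) (U : {vspace vec R I}),
    (forall x, aff_hull P x <-> x - x0 \in U) /\ \dim U = d.

Definition valid_ineq P a (a0 : R) : Prop := forall x, P x -> dot a x <= a0.

Definition face P a (a0 : R) x : Prop := P x /\ dot a x = a0.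

Definition facet_ineq P a (a0 : R) : Prop :=
  valid_ineq P a a0 /\
  exists d : nat, has_dim P d.+1 /\ has_dim (face P a a0) d.

Definition binary x : Prop := forall i, x i = 0 \/ x i = 1.

Definition unit_vec (i : I) : vec R I := [ffun j => (j == i)%:R].

End Polyhedra.

Definition concat (R : realFieldType) (I J : finType)
    (u : vec R I) (v : vec R J) : vec R (I + J)%type :=
  [ffun k => match k with inl i => u i | inr j => v j end].

Notation "u ⊕ v" := (concat u v) (at level 50, left associativity).

(* An edge of K_n is a 2-element set of vertices; the vertices are numbered
   from 0. *)
Notation edge n := {e : {set 'I_n} | #|e| == 2%N}.

Section TravelingSalesman.

Variables (R : realFieldType) (n : nat).
Implicit Types x y z : vec R (edge n).

Definition tour_vec x : Prop :=
  [/\ binary x,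
      forall i : 'I_n, \sum_(e : edge n | i \in val e) x e = 2
    & forall A : {set 'I_n}, A != set0 -> A \proper [set: 'I_n] ->
        \sum_(e : edge n | val e \subset A) x e <= #|A|%:R - 1].

Definition STSP : vec R (edge n) -> Prop := conv_hull tour_vec.

Definition TSD_vec (w : vec R (edge n + edge n + edge n)%type) : Prop :=
  exists x y z,
    [/\ w = x ⊕ y ⊕ z, tour_vec x, tour_vec y, binary z
      & forall e : edge n, x e + y e - z e <= 1].

Definition TSD : vec R (edge n + edge n + edge n)%type -> Prop :=
  conv_hull TSD_vec.

End TravelingSalesman.

(* Main.v *)
From HB Require Import structures.
Require Import Defs.
From mathcomp Require Import all_fingroup.
From mathcomp Require Import lra zify.
Import Order.TTheory GRing.Theory Num.Theory.
Local Open Scope ring_scope.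

Set Implicit Arguments.
Unset Strict Implicit.
Unset Printing Implicit Defensive.

(** Let U be the linear space parallel to the affine hull of the tours, that is,
    the span of the differences of tour vectors.  The space parallel to the
    affine hull of the triples x ⊕ y ⊕ z is then the whole of U × U × R^E: if z
    is identically 1 the tours x and y vary independently, and if moreover
    x = y is a tour that avoids an edge f, then z_f may drop to 0.

    An inequality that is valid on a set P, tight somewhere on P and not
    constant on P defines a facet exactly when the differences of its tight
    points span the hyperplane that it cuts out of the direction space of P
    ([facetP]).  No dimension has to be computed, and since a set and its convex
    hull have the same affine hull, as do their tight subsets, it is enough to
    look at the 0/1 points ([facet_conv_hull]).  In each case one exhibits tight points
    that realise the directions one at a time:
    - for a facet of the tour polytope, imposed on x, tight tours x realise the
      hyperplane of U, while y and z move as before, f being avoided by y;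
      exchanging x and y gives the inequality imposed on y;
    - for z_e <= 1, all pairs of tours with z = 1 are tight, and z_f, f != e, is
      freed by a tour that avoids f;
    - for z_e >= 0, keep z_e = 0 and let one of the two tours avoid e while the
      other is arbitrary; z_f, f != e, is freed by a tour that avoids both
      e and f;
    - for x_e + y_e - z_e <= 1, fix a tour y through e and let z_e = x_e; as x
      varies over all tours, this realises u ⊕ 0 ⊕ u_e 1_e for all u in U, and
      symmetrically for y; if y avoids e and f instead, while x goes through e,
      then z_f, f != e, is free.

    What is needed about tours is thus that one of them goes through any given
    edge ([tour_through]) and that, for n >= 5, one of them avoids any two given
    edges ([tour_avoiding]). *)

(** * Directions of affine hulls and a facet criterion *)

Definition linear_pred (R : realFieldType) (V : lmodType R) (L : V -> Prop) :=
  L 0 /\ forall (c : R) u v, L u -> L v -> L (c *: u + v).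

Section LinearPred.
Variables (R : realFieldType) (V : lmodType R) (L : V -> Prop).
Hypothesis linL : linear_pred L.

Lemma linear_predZ c u : L u -> L (c *: u).
Proof. by move=> Lu; rewrite -[_ *: _]addr0; apply: linL.2 => //; case: linL. Qed.

Lemma linear_predD u v : L u -> L v -> L (u + v).
Proof. by move=> Lu Lv; rewrite -[u]scale1r; apply: linL.2. Qed.

Lemma linear_predB u v : L u -> L v -> L (u - v).
Proof. by move=> Lu Lv; rewrite addrC -scaleN1r; apply: linL.2. Qed.

Lemma linear_pred_sum (J : Type) (r : seq J) (P : pred J) (F : J -> V) :
  (forall j, P j -> L (F j)) -> L (\sum_(j <- r | P j) F j).
Proof. by move=> LF; elim/big_ind: _ => //; [case: linL | exact: linear_predD]. Qed.

End LinearPred.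

Lemma linear_pred_vspace (R : realFieldType) (V : vectType R) (U : {vspace V}) :
  linear_pred (fun v => v \in U).
Proof. by split=> [|c u v Uu Uv]; rewrite ?mem0v // memvD ?memvZ. Qed.

Section Directions.
Variables (R : realFieldType) (I : finType).
Implicit Types (P S : vec R I -> Prop) (U : {vspace vec R I}) (a p q u v : vec R I).

Fact dot_is_linear a : linear (dot a : vec R I -> R^o).
Proof.
move=> c u v; rewrite /dot -[c *: (\sum_i _)]/(c * _) mulr_sumr -big_split.
apply: eq_bigr => i _ /=.
by rewrite !ffunE mulrDr mulrCA.
Qed.
HB.instance Definition _ a :=
  GRing.isLinear.Build R (vec R I) R^o _ (dot a) (dot_is_linear a).

(** U is the span of the differences of points of P.  The span is characterised by
    its universal property for arbitrary linear predicates, because P is a mere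
    proposition and thus gives no finite generating family to compute with. *)
Definition direction_space P U :=
  (forall p q, P p -> P q -> p - q \in U) /\
  (forall L : vec R I -> Prop, linear_pred L ->
     (forall p q, P p -> P q -> L (p - q)) -> forall u, u \in U -> L u).

Lemma eq_direction_space P Q U :
  (forall x, P x <-> Q x) -> direction_space P U -> direction_space Q U.
Proof.
move=> PQ [dP mP]; split=> [p q /PQ Pp /PQ Pq|L lL LQ]; first exact: dP.
by apply: mP => // p q /PQ Qp /PQ Qq; apply: LQ.
Qed.

Lemma aff_hullW P p : P p -> aff_hull P p.
Proof.
by move=> Pp; exists 1%N, (fun=> p), (fun=> 1); rewrite !big_ord1 scale1r.
Qed.

Lemma aff_hull_nonempty P x : aff_hull P x -> exists p, P p.
Proof.
case=> -[|k] [p [w [Pp w1 _]]]; last by exists (p ord0).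
by move: w1; rewrite big_ord0 => /esym/eqP; rewrite oner_eq0.
Qed.

Lemma aff_hull_linear P p : P p -> linear_pred (fun v => aff_hull P (p + v)).
Proof.
move=> Pp; split; first by rewrite addr0; apply: aff_hullW.
move=> c u v [k [r [w [Pr w1 ur]]]] [l [s [w' [Ps w'1 vs]]]].
pose pt (i : 'I_(k + l + 1)) :=
  match split i with
  | inl j => match split j with inl j1 => r j1 | inr j2 => s j2 end
  | inr _ => p end.
pose wt (i : 'I_(k + l + 1)) :=
  match split i with
  | inl j => match split j with inl j1 => c * w j1 | inr j2 => w' j2 end
  | inr _ => - c end.
have splitl (m1 m2 : nat) (i : 'I_m1) : split (lshift m2 i) = inl i.
  exact: (unsplitK (inl i)).
have splitr (m1 m2 : nat) (i : 'I_m2) : split (rshift m1 i) = inr i.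
  exact: (unsplitK (inr i)).
(* p + (c *: u + v) = c *: (p + u) + (p + v) - c *: p has total weight 1. *)
exists (k + l + 1)%N, pt, wt; split.
- by move=> i; rewrite /pt; case: (split i) => // j; case: (split j).
- rewrite !big_split_ord big_ord1 /= /wt splitr.
  under eq_bigr do rewrite !splitl.
  under [X in _ + X + _]eq_bigr do rewrite splitl splitr.
  by rewrite -mulr_sumr w1 w'1 mulr1 addrC addKr.
rewrite !big_split_ord big_ord1 /= /wt /pt !splitr.
under eq_bigr do rewrite !splitl -scalerA.
under [X in _ + X + _]eq_bigr do rewrite splitl splitr.
rewrite -scaler_sumr -ur -vs scalerDr scaleNr.
by rewrite -(addrA (c *: p)) addrAC subrr add0r addrCA.
Qed.

(** Dimension is a property of the direction space alone, so that no base point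
    has to be carried along. *)
Lemma has_dimP P d :
  has_dim P d <->
  (exists p, P p) /\ exists U, direction_space P U /\ \dim U = d.
Proof.
split=> [[x0 [U [affP dU]]]|[[p Pp] [U [[dP mP] dU]]]].
  have aff0 : aff_hull P x0 by apply/affP; rewrite subrr mem0v.
  have [p Pp] := aff_hull_nonempty aff0.
  split; first by exists p.
  exists U; split=> //; split=> [q r Pq Pr|L lL LP u Uu].
    have /affP Uq := aff_hullW Pq; have /affP Ur := aff_hullW Pr.
    by rewrite -(subrKA x0 q) -[x0 - r]opprB memvB.
  have L_aff x : aff_hull P x -> L (x - p).
    move=> [k [q [w [Pq w1 ->]]]].
    have -> : \sum_i w i *: q i - p = \sum_i w i *: (q i - p).
      rewrite -[in LHS](scale1r p) -w1 scaler_suml -sumrB.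
      by apply: eq_bigr => i _; rewrite scalerBr.
    by apply: linear_pred_sum => // i _; apply: linear_predZ => //; apply: LP.
  have affu : aff_hull P (u + x0) by apply/affP; rewrite addrK.
  have -> : u = (u + x0 - p) - (x0 - p) by rewrite opprB subrKA addrK.
  by apply: linear_predB => //; apply: L_aff.
exists p, U; split=> // x; split=> [[k [q [w [Pq w1 ->]]]]|Ux].
  rewrite -(scale1r p) -w1 scaler_suml -sumrB memv_suml // => i _.
  by rewrite -scalerBr memvZ // dP.
rewrite -(subrK p x) addrC.
apply: (mP (fun v => aff_hull P (p + v))) => //; first exact: aff_hull_linear.
move=> q r Pq Pr; rewrite -(subrKA p q) -[p - r]opprB.
have l := aff_hull_linear Pp.
by apply: (linear_predB l); rewrite addrC subrK; apply: aff_hullW.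
Qed.

Lemma conv_hullW S p : S p -> conv_hull S p.
Proof.
by move=> Sp; exists 1%N, (fun=> p), (fun=> 1); split; rewrite ?big_ord1 ?scale1r.
Qed.

Lemma conv_hull_nonempty S x : conv_hull S x -> exists p, S p.
Proof.
by case=> k [p [w [Sp w0 w1 xE]]]; apply: (@aff_hull_nonempty S x); exists k, p, w.
Qed.

Lemma direction_space_conv_hull S U :
  direction_space (conv_hull S) U <-> direction_space S U.
Proof.
have hullL (L : vec R I -> Prop) : linear_pred L ->
    (forall p q, S p -> S q -> L (p - q)) ->
    forall p q, conv_hull S p -> conv_hull S q -> L (p - q).
  move=> lL LS p q hp hq; have [r Sr] := conv_hull_nonempty hp.
  have Lr x : conv_hull S x -> L (x - r).
    case=> k [s [w [Ss _ w1 ->]]]; rewrite -(scale1r r) -w1 scaler_suml -sumrB.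
    apply: linear_pred_sum => // i _; rewrite -scalerBr.
    by apply: linear_predZ => //; apply: LS.
  by rewrite -(subrKA r) -[r - q]opprB; apply: linear_predB => //; apply: Lr.
split=> -[dS mS]; split.
- by move=> p q Sp Sq; apply: dS; apply: conv_hullW.
- by move=> L lL LS; apply: mS => //; apply: hullL.
- by move=> p q; apply: (hullL (fun v => v \in U)) => //; apply: linear_pred_vspace.
by move=> L lL LS; apply: mS => // p q Sp Sq; apply: LS; apply: conv_hullW.
Qed.

Lemma has_dim_conv_hull S d : has_dim (conv_hull S) d <-> has_dim S d.
Proof.
split=> /has_dimP [[p Sp] [U [dU <-]]]; apply/has_dimP; split.
- exact: conv_hull_nonempty Sp.
- by exists U; split=> //; apply/direction_space_conv_hull.
- by exists p; apply: conv_hullW.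
by exists U; split=> //; apply/direction_space_conv_hull.
Qed.

Lemma eq_has_dim P Q d : (forall x, P x <-> Q x) -> has_dim P d -> has_dim Q d.
Proof.
move=> PQ /has_dimP [[p /PQ Qp] [U [dU <-]]]; apply/has_dimP; split.
  by exists p.
by exists U; split=> //; apply: eq_direction_space dU.
Qed.

Lemma dot_conv a k (p : 'I_k -> vec R I) (w : 'I_k -> R) :
  dot a (\sum_i w i *: p i) = \sum_i w i * dot a (p i).
Proof. by rewrite linear_sum; apply: eq_bigr => i _; rewrite linearZ. Qed.

Lemma valid_conv_hull S a (a0 : R) :
  valid_ineq (conv_hull S) a a0 <-> valid_ineq S a a0.
Proof.
split=> vS x; first by move/conv_hullW/vS.
case=> k [p [w [Sp w0 w1 ->]]]; rewrite dot_conv -[a0]mul1r -w1 mulr_suml.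
by apply: ler_sum => i _; rewrite ler_wpM2l // vS.
Qed.

(** A convex combination of points that satisfy the inequality is tight only if
    every point of nonzero weight is; points of weight zero can be replaced by
    any tight point. *)
Lemma face_conv_hull S a (a0 : R) : valid_ineq S a a0 ->
  forall x, face (conv_hull S) a a0 x <-> conv_hull (face S a a0) x.
Proof.
move=> vS x; split; last first.
  case=> k [p [w [Fp w0 w1 ->]]]; split.
    by exists k, p, w; split=> // i; case: (Fp i).
  rewrite dot_conv -[RHS]mul1r -w1 mulr_suml.
  by apply: eq_bigr => i _; rewrite (Fp i).2.
case=> -[k [p [w [Sp w0 w1 ->]]]]; rewrite dot_conv => ax.
have tight i : w i != 0 -> dot a (p i) = a0.
  move=> wi0.
  have : \sum_i w i * (a0 - dot a (p i)) == 0.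
    under eq_bigr do rewrite mulrBr.
    by rewrite sumrB -mulr_suml w1 ax mul1r subrr.
  rewrite psumr_eq0 => [|j _]; last by rewrite mulr_ge0 // subr_ge0 vS.
  move=> /allP/(_ i (mem_index_enum _)) /=.
  by rewrite mulf_eq0 (negPf wi0) subr_eq0 => /eqP.
have [i wi0] : exists i, w i != 0.
  apply/existsP; apply: contraT => /existsPn w_eq0.
  move: w1; rewrite big1 => [/esym/eqP|i _]; first by rewrite oner_eq0.
  by apply/eqP/negPn.
exists k, (fun j => if w j == 0 then p i else p j), w; split=> //.
  by move=> j; case: eqVneq => [_|wj0]; split=> //; apply: tight.
by apply: eq_bigr => j _; case: eqVneq => // ->; rewrite !scale0r.
Qed.

Lemma facet_conv_hull S a (a0 : R) :
  facet_ineq (conv_hull S) a a0 <-> facet_ineq S a a0.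
Proof.
split=> -[vS [d [dS dF]]].
  have vS' : valid_ineq S a a0 by apply/valid_conv_hull.
  split=> //; exists d; split; first exact/has_dim_conv_hull.
  by apply/has_dim_conv_hull; apply: eq_has_dim dF; apply: face_conv_hull.
split; first exact/valid_conv_hull.
exists d; split; first exact/has_dim_conv_hull.
apply: (@eq_has_dim (conv_hull (face S a a0))).
  by move=> x; rewrite face_conv_hull.
exact/has_dim_conv_hull.
Qed.

Definition tight_generated P a (a0 : R) U :=
  forall L : vec R I -> Prop, linear_pred L ->
    (forall p q, face P a a0 p -> face P a a0 q -> L (p - q)) ->
    forall u, u \in U -> dot a u = 0 -> L u.

(** A proper hyperplane section of U has codimension 1.  Conversely, the direction
    space W of a facet lies in this section, and they agree by dimension unless
    a is constant on U; but then every point of P would be tight and W = U. *)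
Lemma facetP P a (a0 : R) U : direction_space P U ->
  facet_ineq P a a0 <->
  [/\ valid_ineq P a a0, exists p, face P a a0 p,
      exists2 u, u \in U & dot a u != 0 & tight_generated P a a0 U].
Proof.
move=> dU; pose f : 'Hom(vec R I, R^o) := linfun (dot a : vec R I -> R^o).
have fE u : (u \in lker f) = (dot a u == 0) by rewrite memv_ker lfunE.
split; last first.
  move=> [vP exF [u0 Uu0 au0] gen]; split=> //.
  have exP : exists p, P p by case: exF => p [Pp _]; exists p.
  exists (\dim (U :&: lker f)); split; apply/has_dimP; split=> //.
    exists U; split=> //; rewrite -(limg_ker_dim f U) -addn1; congr (_ + _)%N.
    apply/eqP; rewrite eqn_leq; apply/andP; split.
      by apply: leq_trans (dimvS (subvf _)) _; rewrite dimvf.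
    rewrite lt0n dimv_eq0; apply: contra au0 => /eqP fU0.
    by have := memv_img f Uu0; rewrite fU0 memv0 lfunE.
  exists (U :&: lker f)%VS; split=> //; split=> [p q [Pp ap] [Pq aq]|L lL LF u].
    by rewrite memv_cap (dU.1 _ _ Pp Pq) fE raddfB /= ap aq subrr /=.
  by rewrite memv_cap fE => /andP[Uu /eqP au]; apply: gen au.
case=> vP [d [/has_dimP [_ [U' [dU' dimU']]] /has_dimP [exF [W [dW dimW]]]]].
have eqU : U' = U.
  apply/eqP; rewrite eqEsubv; apply/andP; split; apply/subvP.
    by apply: dU'.2; [apply: linear_pred_vspace | apply: dU.1].
  by apply: dU.2; [apply: linear_pred_vspace | apply: dU'.1].
rewrite {}eqU {dU'} in dimU'; have [p Fp] := exF.
have subW : (W <= U :&: lker f)%VS.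
  apply/subvP; apply: dW.2; first exact: linear_pred_vspace.
  move=> q r [Pq aq] [Pr ar].
  by rewrite memv_cap (dU.1 _ _ Pq Pr) fE raddfB /= aq ar subrr /=.
have nUk : ~~ (U <= lker f)%VS.
  apply/negP => Uk.
  have UW : (U <= W)%VS.
    apply/subvP; apply: dU.2; first exact: linear_pred_vspace.
    have PF q : P q -> face P a a0 q.
      move=> Pq; split=> //; have /(subvP Uk) := dU.1 _ _ Pq Fp.1.
      by rewrite fE raddfB /= subr_eq0 Fp.2 => /eqP.
    by move=> q r /PF Fq /PF Fr; apply: dW.1.
  by have := dimvS UW; rewrite dimU' dimW ltnn.
have eqW : W = (U :&: lker f)%VS.
  apply/eqP; rewrite eqEdim subW dimW -ltnS -dimU' ltnNge.
  apply: contra nUk => le; have /eqP <- : ((U :&: lker f)%VS == U).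
    by rewrite eqEdim capvSl.
  exact: capvSr.
split=> //.
  by have /subvPn[u Uu] := nUk; rewrite fE => au; exists u.
move=> L lL LF u Uu au; apply: (dW.2 L) => //.
by rewrite eqW memv_cap Uu fE au /=.
Qed.

End Directions.

(** * Tours from vertex orderings *)

Lemma perm_extending_seq (n : nat) (l : seq 'I_n) : uniq l ->
  exists s : {perm 'I_n}, forall (i x : 'I_n), (i < size l)%N ->
    nth x l i = s i.
Proof.
move=> ul; pose l' := l ++ [seq x <- enum 'I_n | x \notin l].
have ul' : uniq l'.
  rewrite cat_uniq ul filter_uniq ?enum_uniq // andbT.
  by apply/hasPn => x; rewrite mem_filter => /andP[].
have sl' : size l' = n.
  rewrite -[RHS]size_enum_ord; apply/perm_size/uniq_perm; rewrite ?enum_uniq //.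
  by move=> x; rewrite mem_cat mem_filter !mem_enum andbT orbN.
have inj : injective (fun i : 'I_n => nth i l' i).
  move=> i j /eqP; rewrite (set_nth_default i j) ?sl' //.
  by rewrite nth_uniq ?sl' // => /eqP/val_inj.
exists (perm inj) => i x il; rewrite permE nth_cat il.
exact: set_nth_default.
Qed.

Lemma exists_notin n (l : seq 'I_n) : (size l < n)%N -> exists x, x \notin l.
Proof.
move=> ln; apply/existsP; apply: contraLR ln => /existsPn all_in.
rewrite -leqNgt -[n in (n <= _)%N]card_ord (leq_trans _ (card_size l)) //.
by apply/subset_leq_card/subsetP => x _; have := all_in x; rewrite negbK.
Qed.

Section Tours.
Variables (R : realFieldType) (n : nat).
Hypothesis n_gt2 : (2 < n)%N.
Implicit Types (s : {perm 'I_n}) (i j : 'I_n) (e : edge n).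

(** The Hamiltonian cycle that visits s 0, s 1, ..., s (n - 1) in this order. *)
Definition perm_tour s : vec R (edge n) :=
  [ffun e => [exists i, val e == [set s i; s (ordS i)]]%:R].

Lemma val_ordS i : ordS i = (if i.+1 == n then 0 else i.+1) :> nat.
Proof.
rewrite /=; case: eqP => [->|/eqP ne]; first exact: modnn.
by rewrite modn_small // ltn_neqAle ne ltn_ord.
Qed.

Lemma eq_ord i j : (i == j) = (i == j :> nat).
Proof. by []. Qed.

Lemma ordS_neq i : ordS i != i.
Proof. by rewrite eq_ord val_ordS; have := ltn_ord i; case: ifP; lia. Qed.

Lemma ordS2_neq i : ordS (ordS i) != i.
Proof.
rewrite eq_ord (val_ordS (ordS i)) (val_ordS i).
by have := ltn_ord i; do 2 case: ifP; lia.
Qed.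

Lemma eq_tour_edge s i j k :
  ([set s i; s j] == [set s k; s (ordS k)]) =
  ((k == i) && (j == ordS i)) || ((k == j) && (i == ordS j)).
Proof.
apply/eqP/orP => [eq_ij|[] /andP[/eqP-> /eqP->] //]; last by rewrite setUC.
have /set2P ik : s k \in [set s i; s j] by rewrite eq_ij set21.
have /set2P iSk : s (ordS k) \in [set s i; s j] by rewrite eq_ij set22.
move: iSk; case: ik => /perm_inj -> [] /perm_inj eqS; rewrite ?eqxx ?eqS ?eqxx.
- by have := ordS_neq i; rewrite eqS eqxx.
- by left.
- by right.
by have := ordS_neq j; rewrite eqS eqxx.
Qed.

Fact tour_edge_card s i : #|[set s i; s (ordS i)]| == 2%N.
Proof. by rewrite cards2 (inj_eq perm_inj) (eq_sym i) ordS_neq. Qed.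

Definition tour_edge s i : edge n := Sub [set s i; s (ordS i)] (tour_edge_card s i).

Lemma tour_edge_inj s : injective (tour_edge s).
Proof.
move=> i k /(congr1 val) /eqP; rewrite /= eq_tour_edge.
case/orP => /andP[/eqP-> //]; rewrite eq_sym => e.
by have := ordS2_neq i; rewrite e.
Qed.

Lemma perm_tourE s e : perm_tour s e = \sum_i (tour_edge s i == e)%:R.
Proof.
rewrite ffunE; case: existsP => [[i /eqP ei]|noi].
  have {ei} -> : e = tour_edge s i by apply: val_inj.
  rewrite (bigD1 i) //= eqxx big1 ?addr0 // => k ki.
  by rewrite (inj_eq (@tour_edge_inj s)) (negPf ki).
rewrite big1 // => i _; case: eqP => // ei.
by case: noi; exists i; rewrite -ei.
Qed.

(** A sum over the edges of the cycle becomes a sum over positions, since for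
    n >= 3 distinct positions i have distinct edges {s i, s (i + 1)}. *)
Lemma sum_perm_tour s (Q : pred {set 'I_n}) :
  \sum_(e : edge n | Q (val e)) perm_tour s e =
  \sum_i (Q [set s i; s (ordS i)])%:R.
Proof.
under eq_bigr do rewrite perm_tourE.
rewrite exchange_big; apply: eq_bigr => i _ /=.
rewrite big_mkcond (bigD1 (tour_edge s i)) //= eqxx big1 ?addr0.
  by case: ifP.
by move=> e ei; rewrite eq_sym (negPf ei); case: ifP.
Qed.

Lemma ordS_closed_full (B : {set 'I_n}) :
  B != set0 -> (forall i, i \in B -> ordS i \in B) -> B = [set: 'I_n].
Proof.
case/set0Pn=> i Bi BS; apply/setP => j; rewrite inE.
have step k : forall m : nat, (m = (i + k) %% n)%N ->
    exists2 l : 'I_n, l \in B & l = m :> nat.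
  elim: k => [|k IH] m ->; first by exists i; rewrite // addn0 modn_small.
  have [l Bl lE] := IH _ erefl; exists (ordS l); first exact: BS.
  by rewrite /= lE -addn1 modnDml addn1 addnS.
have [|l Bl lE] := step (n - i + j)%N j; last by rewrite -(val_inj lE).
by rewrite addnA subnKC 1?ltnW // modnDl modn_small.
Qed.

(** The vertex s j lies on the edges of positions j and j - 1 only.  A vertex set A
    pulls back to a set B of positions, and the edges inside A are the i in B
    with i + 1 in B; these are fewer than #|B|, as a nonempty set of positions
    closed under successor is everything. *)
Lemma perm_tour_vec s : tour_vec (perm_tour s).
Proof.
split=> [e|v|A A0 AT].
- by rewrite ffunE; case: [exists _, _]; [right|left].
- have [j {v}->] : exists j, v = s j by exists ((s^-1)%g v); rewrite permKV.
  rewrite (@sum_perm_tour s (fun B => s j \in B)).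
  under eq_bigr => i _ do rewrite !inE !(inj_eq perm_inj).
  rewrite (bigD1 j) //= eqxx (bigD1 (ord_pred j)) /=; last first.
    by rewrite -(inj_eq (@ordS_inj n)) ord_predK eq_sym ordS_neq.
  rewrite ord_predK eqxx orbT big1 ?addr0 // => i /andP[ij ip].
  rewrite eq_sym (negPf ij) /= -(inj_eq (@ord_pred_inj n)) ordSK eq_sym.
  by rewrite (negPf ip).
rewrite (@sum_perm_tour s (fun B => B \subset A)) -natr_sum lerBrDr.
rewrite natr1 ler_nat.
pose B := s @^-1: A.
have -> : #|A| = #|B|.
  by rewrite on_card_preimset //; apply: onW_bij; exists (s^-1)%g;
   [exact: permK | exact: permKV].
have -> : (\sum_i ([set s i; s (ordS i)] \subset A) =
    #|[set i in B | ordS i \in B]|)%N.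
  rewrite -sum1dep_card [RHS]big_mkcond; apply: eq_bigr => i _.
  by rewrite subUset !sub1set !inE; case: (_ && _).
apply: proper_card; rewrite properE; apply/andP; split.
  by apply/subsetP => i; rewrite inE => /andP[].
apply: contraL AT => /subsetP BS; rewrite properE negb_and negbK; apply/orP; right.
have B0 : B != set0.
  have [v Av] := set0Pn _ A0; apply/set0Pn; exists ((s^-1)%g v).
  by rewrite inE permKV.
have BT : B = setT.
  by apply: ordS_closed_full => // i /BS; rewrite inE => /andP[].
apply/subsetP => v _; have : (s^-1)%g v \in B by rewrite BT inE.
by rewrite inE permKV.
Qed.

Lemma perm_tour_at s e i j : val e = [set s i; s j] ->
  perm_tour s e = ((j == ordS i) || (i == ordS j))%:R.
Proof.
move=> eE; rewrite ffunE eE; congr (nat_of_bool _)%:R.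
apply/existsP/orP => [[k]|[/eqP ->|/eqP ->]].
- by rewrite eq_tour_edge => /orP[] /andP[_]; auto.
- by exists i.
by exists j; rewrite setUC.
Qed.

Lemma edgeP e : exists a b, a != b /\ val e = [set a; b].
Proof. by have /cards2P[a [b [ab ->]]] := valP e; exists a, b. Qed.

Lemma tour_through e : exists2 x : vec R (edge n), tour_vec x & x e = 1.
Proof.
have [a [b [ab eE]]] := edgeP e.
have [|s sE] := @perm_extending_seq n [:: a; b]; first by rewrite /= inE ab.
have n0 : (0 < n)%N by lia.
have n1 : (1 < n)%N by lia.
exists (perm_tour s); first exact: perm_tour_vec.
rewrite (@perm_tour_at s e (Ordinal n0) (Ordinal n1)); last first.
  by rewrite -!(sE _ a).
have -> // : Ordinal n1 == ordS (Ordinal n0).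
by rewrite eq_ord val_ordS /=; case: ifP; lia.
Qed.

End Tours.

(** Two vertices at positions i < j are not consecutive if i + 1 < j <= 3, because
    n >= 5 keeps the position 3 away from the last one.  Disjoint edges
    ab and cd are avoided by a tour starting with a, c, b, d; edges ab and ac
    by one starting with a, x, b, c. *)
Lemma tour_avoiding (R : realFieldType) (n : nat) (e f : edge n) : (4 < n)%N ->
  exists x : vec R (edge n), [/\ tour_vec x, x e = 0 & x f = 0].
Proof.
move=> n5; have n_gt2 : (2 < n)%N by lia.
have n0 : (0 < n)%N by lia.
have n1 : (1 < n)%N by lia.
have n3 : (3 < n)%N by lia.
have nonadj i j (ni : (i < n)%N) (nj : (j < n)%N) : (i.+1 < j)%N -> (j < 4)%N ->
    ((Ordinal nj == ordS (Ordinal ni)) || (Ordinal ni == ordS (Ordinal nj)))%:R = 0 :> R.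
  move=> ij j4; rewrite (_ : _ || _ = false) // !eq_ord !val_ordS /=.
  by do 2 case: ifP; lia.
have [/eqP/setP ef0|/set0Pn[a]] := boolP (val e :&: val f == set0).
  have [a [b [ab eE]]] := edgeP e; have [c [d [cd fE]]] := edgeP f.
  have := ef0 c; have := ef0 d.
  rewrite eE fE !inE !eqxx orbT !andbT => /norP[da db] /norP[ca cb].
  have [|s sE] := @perm_extending_seq n [:: a; c; b; d].
    by rewrite /= !inE !negb_or ab cd cb (eq_sym a c) ca (eq_sym a) da (eq_sym b) db.
  exists (perm_tour R s); split; first exact: perm_tour_vec.
    rewrite (@perm_tour_at _ _ _ s e (Ordinal n0) (Ordinal n_gt2)) ?nonadj //.
    by rewrite -!(sE _ a).
  rewrite (@perm_tour_at _ _ _ s f (Ordinal n1) (Ordinal n3)) ?nonadj //.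
  by rewrite -!(sE _ a).
have sideP (g : edge n) : a \in val g -> exists2 b, a != b & val g = [set a; b].
  have [b [c [bc ->]]] := edgeP g; rewrite !inE => /orP[] /eqP ->.
    by exists c.
  by exists b; rewrite 1?eq_sym // setUC.
rewrite inE => /andP[/sideP[b ab eE] /sideP[c ac fE]].
(* When e = f the vertex c coincides with b, and any other vertex takes its place. *)
have [c' [c'ab c'c]] : exists c', c' \notin [:: a; b] /\ (c = b \/ c = c').
  have [->|cb] := eqVneq c b.
    by have [|c' ?] := @exists_notin n [:: a; b]; [rewrite /=; lia | exists c'; auto].
  by exists c; split; auto; rewrite !inE eq_sym (negPf ac).
have [|x xabc] := @exists_notin n [:: a; b; c']; first by rewrite /=; lia.
have [|s sE] := @perm_extending_seq n [:: a; x; b; c'].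
  move: c'ab xabc; rewrite /= !inE !negb_or (eq_sym a x) (eq_sym a c') (eq_sym b c').
  by move=> /andP[-> ->] /and3P[-> -> ->]; rewrite ab.
have xe : perm_tour R s e = 0.
  rewrite (@perm_tour_at _ _ _ s e (Ordinal n0) (Ordinal n_gt2)) ?nonadj //.
  by rewrite -!(sE _ a).
exists (perm_tour R s); split=> //; first exact: perm_tour_vec.
case: c'c fE => -> fE.
  by rewrite -xe; congr (perm_tour R s _); apply: val_inj; rewrite fE eE.
rewrite (@perm_tour_at _ _ _ s f (Ordinal n0) (Ordinal n3)) ?nonadj //.
by rewrite -!(sE _ a).
Qed.

(** * Concatenation of vectors *)

Section Concat.
Variables (R : realFieldType) (I J : finType).
Implicit Types (u a : vec R I) (v b : vec R J).

Lemma concat_linear c u v u' v' :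
  c *: (u ⊕ v) + (u' ⊕ v') = (c *: u + u') ⊕ (c *: v + v').
Proof. by apply/ffunP => -[i|j]; rewrite !ffunE. Qed.

Lemma dot_concat a b u v : dot (a ⊕ b) (u ⊕ v) = dot a u + dot b v.
Proof.
rewrite /dot big_sumType /=.
by congr (_ + _); apply: eq_bigr => i _; rewrite !ffunE.
Qed.

Lemma dot_unit_vec (i : I) u : dot (unit_vec R i) u = u i.
Proof.
rewrite /dot (bigD1 i) //= ffunE eqxx mul1r big1 ?addr0 // => j ji.
by rewrite ffunE (negPf ji) mul0r.
Qed.

Lemma dotNl a u : dot (- a) u = - dot a u.
Proof. by rewrite /dot -sumrN; apply: eq_bigr => i _; rewrite !ffunE mulNr. Qed.

Lemma dot0l u : dot 0 u = 0.
Proof. by rewrite /dot big1 // => i _; rewrite ffunE mul0r. Qed.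

Lemma unit_vec_sum u : u = \sum_i u i *: unit_vec R i.
Proof.
apply/ffunP => j; rewrite sum_ffunE (bigD1 j) //= big1 ?addr0 => [|i ij].
  by rewrite !ffunE eqxx [_ *: _]mulr1.
by rewrite !ffunE eq_sym (negPf ij) scaler0.
Qed.

End Concat.

(** * Triples and linear predicates on them *)

Section Triples.
Variables (R : realFieldType) (E : finType).
Implicit Types (x y z u v w : vec R E) (L : vec R (E + E + E)%type -> Prop).

Lemma concat3B x y z x' y' z' :
  (x ⊕ y ⊕ z) - (x' ⊕ y' ⊕ z') = (x - x') ⊕ (y - y') ⊕ (z - z').
Proof. by apply/ffunP => -[[e|e]|e]; rewrite !ffunE. Qed.

Lemma concat3D x y z x' y' z' :
  (x ⊕ y ⊕ z) + (x' ⊕ y' ⊕ z') = (x + x') ⊕ (y + y') ⊕ (z + z').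
Proof. by apply/ffunP => -[[e|e]|e]; rewrite !ffunE. Qed.

Lemma dot_concat3 x y z u v w :
  dot (x ⊕ y ⊕ z) (u ⊕ v ⊕ w) = dot x u + dot y v + dot z w.
Proof. by rewrite !dot_concat. Qed.

Lemma linear_pred_concat3 L (f g h : vec R E -> vec R E) :
  linear f -> linear g -> linear h -> linear_pred L ->
  linear_pred (fun u => L (f u ⊕ g u ⊕ h u)).
Proof.
move=> lf lg lh lL.
have lin0 k : linear k -> k 0 = 0 :> vec R E.
  move=> lk; have := lk (-1) 0 0.
  by rewrite scaler0 addr0 scaleN1r addNr.
split.
  rewrite !lin0 //; suff -> : 0 ⊕ 0 ⊕ 0 = 0 :> vec R (E + E + E)%type by case: lL.
  by apply/ffunP => -[[e|e]|e]; rewrite !ffunE.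
by move=> c u v Lu Lv; rewrite lf lg lh -!concat_linear; apply: lL.2.
Qed.

Lemma linear_id : linear (fun u => u).
Proof. by []. Qed.

Lemma linear_zero : linear (fun _ : vec R E => 0 : vec R E).
Proof. by move=> c u v; rewrite scaler0 addr0. Qed.

Lemma linear_at e : linear (fun u => u e *: unit_vec R e).
Proof.
by move=> c u v; rewrite !ffunE scalerDl scalerA.
Qed.

Lemma linear_pred_fst L : linear_pred L -> linear_pred (fun u => L (u ⊕ 0 ⊕ 0)).
Proof. exact/linear_pred_concat3/linear_zero/linear_zero/linear_id. Qed.

Lemma linear_pred_snd L : linear_pred L -> linear_pred (fun u => L (0 ⊕ u ⊕ 0)).
Proof. exact/linear_pred_concat3/linear_zero/linear_id/linear_zero. Qed.

Lemma linear_pred_trd L w : linear_pred L ->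
  (forall f, w f != 0 -> L (0 ⊕ 0 ⊕ unit_vec R f)) -> L (0 ⊕ 0 ⊕ w).
Proof.
move=> lL Lw.
have lL3 := linear_pred_concat3 linear_zero linear_zero linear_id lL.
rewrite [w]unit_vec_sum; apply: (linear_pred_sum lL3) => f _.
have [->|wf] := eqVneq (w f) 0; first by rewrite scale0r; case: lL3.
exact: (linear_predZ lL3) (Lw f wf).
Qed.

Lemma linear_pred_blocks L u v w : linear_pred L ->
  L (u ⊕ 0 ⊕ 0) -> L (0 ⊕ v ⊕ 0) ->
  (forall f, w f != 0 -> L (0 ⊕ 0 ⊕ unit_vec R f)) -> L (u ⊕ v ⊕ w).
Proof.
move=> lL Lu Lv /(linear_pred_trd lL) Lw.
have := linear_predD lL (linear_predD lL Lu Lv) Lw.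
by rewrite !concat3D !addr0 !add0r.
Qed.

Definition block1 (t : vec R (E + E + E)%type) : vec R E := [ffun e => t (inl (inl e))].
Definition block2 (t : vec R (E + E + E)%type) : vec R E := [ffun e => t (inl (inr e))].
Definition block3 (t : vec R (E + E + E)%type) : vec R E := [ffun e => t (inr e)].

Fact block1_is_linear : linear block1.
Proof. by move=> c s t; apply/ffunP => e; rewrite !ffunE. Qed.
Fact block2_is_linear : linear block2.
Proof. by move=> c s t; apply/ffunP => e; rewrite !ffunE. Qed.
HB.instance Definition _ := GRing.isLinear.Build R _ _ _ block1 block1_is_linear.
HB.instance Definition _ := GRing.isLinear.Build R _ _ _ block2 block2_is_linear.

Lemma blocksK t : t = block1 t ⊕ block2 t ⊕ block3 t.
Proof. by apply/ffunP => -[[e|e]|e]; rewrite !ffunE. Qed.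

Definition product_space (U : {vspace vec R E}) : {vspace vec R (E + E + E)%type} :=
  (linfun block1 @^-1: U :&: linfun block2 @^-1: U)%VS.

Lemma product_spaceE U u v w :
  (u ⊕ v ⊕ w \in product_space U) = (u \in U) && (v \in U).
Proof.
rewrite memv_cap -!memv_preim !lfunE.
by congr ((_ \in U) && (_ \in U)); apply/ffunP => e; rewrite !ffunE.
Qed.

End Triples.

(** * Facets of the pairs-of-tours polytope *)

Section SymmetricDifference.
Variables (R : realFieldType) (n : nat).
Hypothesis n_gt4 : (4 < n)%N.
Variable (U : {vspace vec R (edge n)}).
Hypothesis dU : direction_space (@tour_vec R n) U.
Implicit Types (x y z u v w : vec R (edge n)) (e f : edge n).

(** Coordinates of z equal to 1 put no condition on the two tours, so a vector z
    is given by the list l of its zeros. *)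
Definition except (l : seq (edge n)) : vec R (edge n) := [ffun e => (e \notin l)%:R].

Lemma TSD_vec_except l x y : tour_vec x -> tour_vec y ->
  (forall e, e \in l -> x e = 0 \/ y e = 0) -> TSD_vec (x ⊕ y ⊕ except l).
Proof.
move=> tx ty xyl; exists x, y, (except l); split=> // e.
  by rewrite ffunE; case: (_ \notin _); [right|left].
have [bx _ _] := tx; have [by0 _ _] := ty; rewrite ffunE.
case: (boolP (e \in l)) => [/xyl exy|_] /=.
  by case: exy => ->; [case: (by0 e) | case: (bx e)] => ->; lra.
by case: (bx e) => ->; case: (by0 e) => ->; lra.
Qed.

Lemma exceptB l f : f \notin l -> except l - except (f :: l) = unit_vec R f.
Proof.
move=> fl; apply/ffunP => e; rewrite !ffunE inE.
by case: eqVneq => [->|_] /=; rewrite ?fl ?subr0 ?subrr.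
Qed.

(** Every pair of tours extends by z = 1, which gives the first two blocks; a tour
    x = y avoiding f allows both values of z_f, which gives the third. *)
Lemma TSD_direction_space : direction_space (@TSD_vec R n) (product_space U).
Proof.
split=> [_ _ [x [y [z [-> tx ty _ _]]]] [x' [y' [z' [-> tx' ty' _ _]]]]|L lL LT t].
  by rewrite concat3B product_spaceE !dU.1.
rewrite [t]blocksK product_spaceE => /andP[Ux Uy].
have some_tour : exists x : vec R (edge n), tour_vec x.
  by exists (perm_tour R 1); apply: perm_tour_vec; lia.
have [s ts] := some_tour; apply: linear_pred_blocks => //.
- apply: (dU.2 (fun u => L (u ⊕ 0 ⊕ 0))) Ux; first exact: linear_pred_fst.
  move=> x x' tx tx'; have := LT (x ⊕ s ⊕ except [::]) (x' ⊕ s ⊕ except [::]).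
  by rewrite concat3B !subrr; apply; apply: TSD_vec_except.
- apply: (dU.2 (fun u => L (0 ⊕ u ⊕ 0))) Uy; first exact: linear_pred_snd.
  move=> y y' ty ty'; have := LT (s ⊕ y ⊕ except [::]) (s ⊕ y' ⊕ except [::]).
  by rewrite concat3B !subrr; apply; apply: TSD_vec_except.
move=> f _; have [x [tx xf _]] := tour_avoiding R f f n_gt4.
have := LT (x ⊕ x ⊕ except [::]) (x ⊕ x ⊕ except [:: f]).
rewrite concat3B !subrr exceptB //; apply; apply: TSD_vec_except => //.
by move=> e; rewrite inE => /eqP ->; left.
Qed.

(** Tight tours x move along the hyperplane of U, with y and z fixed; y moves freely
    with z = 1, and z_f moves when y avoids f. *)
Lemma TSD_facet_fst a (a0 : R) :
  facet_ineq (@tour_vec R n) a a0 -> facet_ineq (@TSD_vec R n) (a ⊕ 0 ⊕ 0) a0.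
Proof.
move=> /(facetP a a0 dU) [va [p [tp ap]] [u0 Uu0 au0] gen].
have dotE u v w : dot (a ⊕ 0 ⊕ 0) (u ⊕ v ⊕ w) = dot a u.
  by rewrite dot_concat3 !dot0l !addr0.
apply/(facetP _ _ TSD_direction_space); split.
- by move=> _ [x [y [z [-> tx _ _ _]]]]; rewrite dotE; apply: va.
- exists (p ⊕ p ⊕ except [::]); split; last by rewrite dotE.
  exact: TSD_vec_except.
- by exists (u0 ⊕ 0 ⊕ 0); rewrite ?dotE // product_spaceE Uu0 mem0v.
move=> L lL LF t; rewrite [t]blocksK product_spaceE dotE => /andP[Ux Uy] ax.
apply: linear_pred_blocks => //.
- apply: (gen (fun u => L (u ⊕ 0 ⊕ 0))) ax => //; first exact: linear_pred_fst.
  move=> x x' [tx ax] [tx' ax'].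
  have := LF (x ⊕ p ⊕ except [::]) (x' ⊕ p ⊕ except [::]).
  rewrite concat3B !subrr; apply; split; rewrite ?dotE //.
    exact: TSD_vec_except.
  exact: TSD_vec_except.
- apply: (dU.2 (fun u => L (0 ⊕ u ⊕ 0))) Uy; first exact: linear_pred_snd.
  move=> y y' ty ty'; have := LF (p ⊕ y ⊕ except [::]) (p ⊕ y' ⊕ except [::]).
  rewrite concat3B !subrr; apply; split; rewrite ?dotE //.
    exact: TSD_vec_except.
  exact: TSD_vec_except.
move=> f _; have [y [ty yf _]] := tour_avoiding R f f n_gt4.
have := LF (p ⊕ y ⊕ except [::]) (p ⊕ y ⊕ except [:: f]).
rewrite concat3B !subrr exceptB //; apply; split; rewrite ?dotE //.
  exact: TSD_vec_except.
by apply: TSD_vec_except => // e; rewrite inE => /eqP ->; right.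
Qed.

(** The defining conditions are symmetric in x and y, so exchanging the first two
    blocks carries tight points to tight points. *)
Lemma TSD_facet_snd a (a0 : R) :
  facet_ineq (@TSD_vec R n) (a ⊕ 0 ⊕ 0) a0 -> facet_ineq (@TSD_vec R n) (0 ⊕ a ⊕ 0) a0.
Proof.
pose sw (t : vec R (edge n + edge n + edge n)%type) := block2 t ⊕ block1 t ⊕ block3 t.
have swE u v w : sw (u ⊕ v ⊕ w) = v ⊕ u ⊕ w.
  by apply/ffunP => -[[e|e]|e]; rewrite !ffunE.
have dot_sw t : dot (0 ⊕ a ⊕ 0) (sw t) = dot (a ⊕ 0 ⊕ 0) t.
  by rewrite [t in RHS]blocksK !dot_concat3 !dot0l add0r !addr0.
have swK t : sw (sw t) = t by rewrite [t]blocksK !swE.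
have T_sw t : TSD_vec t -> TSD_vec (sw t).
  case=> x [y [z [-> tx ty bz le]]]; rewrite swE; exists y, x, z; split=> // e.
  by rewrite [y e + _]addrC.
have F_sw t : face (@TSD_vec R n) (a ⊕ 0 ⊕ 0) a0 t ->
    face (@TSD_vec R n) (0 ⊕ a ⊕ 0) a0 (sw t).
  by case=> Tt at0; split; [apply: T_sw | rewrite dot_sw].
have U_sw t : t \in product_space U -> sw t \in product_space U.
  by rewrite [t]blocksK swE !product_spaceE andbC.
move=> /(facetP _ _ TSD_direction_space) [va [p Fp] [u0 Uu0 au0] gen].
apply/(facetP _ _ TSD_direction_space); split.
- by move=> t /T_sw/va; rewrite -dot_sw swK.
- by exists (sw p); apply: F_sw.
- by exists (sw u0); [apply: U_sw | rewrite dot_sw].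
move=> L lL LF t /U_sw Ut; rewrite -[t]swK dot_sw.
apply: (gen (fun t => L (sw t))) => //.
  split=> [|c u v Lu Lv].
    suff -> : sw 0 = 0 by case: lL.
    by apply/ffunP => -[[e|e]|e]; rewrite !ffunE.
  suff -> : sw (c *: u + v) = c *: sw u + sw v by apply: lL.2.
  by apply/ffunP => -[[e|e]|e]; rewrite !ffunE.
move=> q r /F_sw Fq /F_sw Fr; have := LF _ _ Fq Fr.
by rewrite [q]blocksK [r]blocksK concat3B !swE concat3B.
Qed.

(** With z_e = 0 only one tour may use e: a tour s that avoids e stays fixed while
    the other one is arbitrary. *)
Lemma TSD_facet_ge0 e : facet_ineq (@TSD_vec R n) (0 ⊕ 0 ⊕ (- unit_vec R e)) 0.
Proof.
have dotE u v w : dot (0 ⊕ 0 ⊕ (- unit_vec R e)) (u ⊕ v ⊕ w) = - w e.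
  by rewrite dot_concat3 !dot0l !add0r dotNl dot_unit_vec.
have [s [ts se _]] := tour_avoiding R e e n_gt4.
have Fx x : tour_vec x ->
    face (@TSD_vec R n) (0 ⊕ 0 ⊕ (- unit_vec R e)) 0 (x ⊕ s ⊕ except [:: e]).
  move=> tx; split; last by rewrite dotE ffunE inE eqxx oppr0.
  by apply: TSD_vec_except => // g; rewrite inE => /eqP->; right.
have Fy y : tour_vec y ->
    face (@TSD_vec R n) (0 ⊕ 0 ⊕ (- unit_vec R e)) 0 (s ⊕ y ⊕ except [:: e]).
  move=> ty; split; last by rewrite dotE ffunE inE eqxx oppr0.
  by apply: TSD_vec_except => // g; rewrite inE => /eqP->; left.
apply/(facetP _ _ TSD_direction_space); split.
- move=> _ [x [y [z [-> _ _ bz _]]]]; rewrite dotE oppr_le0.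
  by case: (bz e) => ->.
- by exists (s ⊕ s ⊕ except [:: e]); apply: Fx.
- exists (0 ⊕ 0 ⊕ unit_vec R e); first by rewrite product_spaceE mem0v.
  by rewrite dotE ffunE eqxx oppr_eq0 oner_eq0.
move=> L lL LF t; rewrite [t]blocksK product_spaceE dotE => /andP[Ux Uy] te.
apply: linear_pred_blocks => //.
- apply: (dU.2 (fun u => L (u ⊕ 0 ⊕ 0))) Ux; first exact: linear_pred_fst.
  by move=> x x' /Fx Fx1 /Fx Fx2; have := LF _ _ Fx1 Fx2; rewrite concat3B !subrr.
- apply: (dU.2 (fun u => L (0 ⊕ u ⊕ 0))) Uy; first exact: linear_pred_snd.
  by move=> y y' /Fy Fy1 /Fy Fy2; have := LF _ _ Fy1 Fy2; rewrite concat3B !subrr.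
move=> f tf.
have fe : f != e by apply: contra_neq tf => ->; apply/eqP; rewrite -oppr_eq0 te.
have [x [tx xe xf]] := tour_avoiding R e f n_gt4.
have := LF (x ⊕ x ⊕ except [:: e]) (x ⊕ x ⊕ except [:: f; e]).
rewrite concat3B !subrr exceptB ?inE //; apply; split.
- by apply: TSD_vec_except => // g; rewrite inE => /eqP->; left.
- by rewrite dotE ffunE inE eqxx oppr0.
- by apply: TSD_vec_except => // g; rewrite !inE => /orP[] /eqP->; left.
by rewrite dotE ffunE !inE eqxx orbT oppr0.
Qed.

(** With z = 1 both tours are arbitrary, and z_f for f != e is freed by tours that
    avoid f. *)
Lemma TSD_facet_le1 e : facet_ineq (@TSD_vec R n) (0 ⊕ 0 ⊕ unit_vec R e) 1.
Proof.
have dotE u v w : dot (0 ⊕ 0 ⊕ unit_vec R e) (u ⊕ v ⊕ w) = w e.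
  by rewrite dot_concat3 !dot0l !add0r dot_unit_vec.
have [s [ts _ _]] := tour_avoiding R e e n_gt4.
have F x y : tour_vec x -> tour_vec y ->
    face (@TSD_vec R n) (0 ⊕ 0 ⊕ unit_vec R e) 1 (x ⊕ y ⊕ except [::]).
  by move=> tx ty; split; [apply: TSD_vec_except | rewrite dotE ffunE].
apply/(facetP _ _ TSD_direction_space); split.
- by move=> _ [x [y [z [-> _ _ bz _]]]]; rewrite dotE; case: (bz e) => ->.
- by exists (s ⊕ s ⊕ except [::]); apply: F.
- exists (0 ⊕ 0 ⊕ unit_vec R e); first by rewrite product_spaceE mem0v.
  by rewrite dotE ffunE eqxx oner_eq0.
move=> L lL LF t; rewrite [t]blocksK product_spaceE dotE => /andP[Ux Uy] te.
apply: linear_pred_blocks => //.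
- apply: (dU.2 (fun u => L (u ⊕ 0 ⊕ 0))) Ux; first exact: linear_pred_fst.
  move=> x x' tx tx'; have := LF _ _ (F _ _ tx ts) (F _ _ tx' ts).
  by rewrite concat3B !subrr.
- apply: (dU.2 (fun u => L (0 ⊕ u ⊕ 0))) Uy; first exact: linear_pred_snd.
  move=> y y' ty ty'; have := LF _ _ (F _ _ ts ty) (F _ _ ts ty').
  by rewrite concat3B !subrr.
move=> f tf; have fe : f != e by apply: contra_neq tf => ->.
have [x [tx xf _]] := tour_avoiding R f f n_gt4.
have := LF _ (x ⊕ x ⊕ except [:: f]) (F _ _ tx tx).
rewrite concat3B !subrr exceptB //; apply; split.
  by apply: TSD_vec_except => // g; rewrite inE => /eqP->; left.
by rewrite dotE ffunE inE eq_sym fe.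
Qed.

(** The tight directions (u, v, w) satisfy w_e = u_e + v_e; they split as
    (u, 0, u_e 1_e) + (0, v, v_e 1_e) + (0, 0, w') with w'_e = 0.  Fixing one
    tour s through e, tightness forces z_e = x_e for the other tour x, so that
    all tours x contribute a direction of the first kind. *)
Lemma TSD_facet_overlap e :
  facet_ineq (@TSD_vec R n) (unit_vec R e ⊕ unit_vec R e ⊕ (- unit_vec R e)) 1.
Proof.
set a := _ ⊕ _ ⊕ _.
have dotE u v w : dot a (u ⊕ v ⊕ w) = u e + v e - w e.
  by rewrite dot_concat3 dotNl !dot_unit_vec.
have [s ts se] : exists2 x : vec R (edge n), tour_vec x & x e = 1.
  by apply: tour_through; lia.
(* The values x_e + s_e - z_e = 1 and s_e = 1 force z_e = x_e. *)
pose z x := except (if x e == 0 then [:: e] else [::]).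
have zE x x' : tour_vec x -> tour_vec x' -> z x - z x' = (x - x') e *: unit_vec R e.
  move=> [bx _ _] [bx' _ _]; rewrite [(x - x') e]ffunE [(- x') e]ffunE /z.
  case: (bx e) => ->; case: (bx' e) => ->; rewrite ?eqxx ?oner_eq0.
  - by rewrite !subrr scale0r.
  - by rewrite -opprB exceptB // sub0r scaleN1r.
  - by rewrite exceptB // subr0 scale1r.
  by rewrite !subrr scale0r.
have z_e x : tour_vec x -> z x e = x e.
  move=> [bx _ _]; rewrite /z; case: (bx e) => ->; rewrite ?eqxx ?oner_eq0 ffunE ?inE //.
  by rewrite eqxx.
have z_in x g : g \in (if x e == 0 then [:: e] else [::]) -> x g = 0.
  by case: eqP => // xe; rewrite inE => /eqP->.
have Fx x : tour_vec x -> face (@TSD_vec R n) a 1 (x ⊕ s ⊕ z x).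
  move=> tx; split; last by rewrite dotE z_e // se addrC addKr.
  by apply: TSD_vec_except => // g /z_in; left.
have Fy y : tour_vec y -> face (@TSD_vec R n) a 1 (s ⊕ y ⊕ z y).
  move=> ty; split; last by rewrite dotE z_e // se addrK.
  by apply: TSD_vec_except => // g /z_in; right.
apply/(facetP _ _ TSD_direction_space); split.
- by move=> _ [x [y [w [-> _ _ _ le]]]]; rewrite dotE.
- by exists (s ⊕ s ⊕ z s); apply: Fx.
- exists (0 ⊕ 0 ⊕ unit_vec R e); first by rewrite product_spaceE mem0v.
  by rewrite dotE !ffunE eqxx !add0r oppr_eq0 oner_eq0.
move=> L lL LF t; rewrite [t]blocksK product_spaceE dotE.
move: (block1 t) (block2 t) (block3 t) => u v w /andP[Uu Uv] te.
pose w' := w - (u e + v e) *: unit_vec R e.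
have w'e : w' e = 0.
  have at_e c : (c *: unit_vec R e) e = c by rewrite !ffunE eqxx [_ *: _]mulr1.
  by rewrite [LHS]ffunE [X in w e + X]ffunE at_e -opprB te oppr0.
have Lw : L (0 ⊕ 0 ⊕ w').
  apply: (linear_pred_trd lL) => f.
  have [->|fe _] := eqVneq f e.
    by rewrite w'e eqxx.
  have [y [ty ye yf]] := tour_avoiding R e f n_gt4.
  have := LF (s ⊕ y ⊕ except [:: e]) (s ⊕ y ⊕ except [:: f; e]).
  rewrite concat3B !subrr exceptB ?inE //; apply; split.
  - by apply: TSD_vec_except => // g; rewrite inE => /eqP->; right.
  - by rewrite dotE se ye ffunE inE eqxx subr0 addr0.
  - by apply: TSD_vec_except => // g; rewrite !inE => /orP[] /eqP->; right.
  by rewrite dotE se ye ffunE !inE eqxx orbT subr0 addr0.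
have Lu : L (u ⊕ 0 ⊕ (u e *: unit_vec R e)).
  apply: (dU.2 (fun u => L (u ⊕ 0 ⊕ (u e *: unit_vec R e)))) Uu.
    by apply: linear_pred_concat3; [apply: linear_id|apply: linear_zero|apply: linear_at|].
  move=> x x' tx tx'; have := LF _ _ (Fx _ tx) (Fx _ tx').
  by rewrite concat3B subrr zE.
have Lv : L (0 ⊕ v ⊕ (v e *: unit_vec R e)).
  apply: (dU.2 (fun u => L (0 ⊕ u ⊕ (u e *: unit_vec R e)))) Uv.
    by apply: linear_pred_concat3; [apply: linear_zero|apply: linear_id|apply: linear_at|].
  move=> x x' tx tx'; have := LF _ _ (Fy _ tx) (Fy _ tx').
  by rewrite concat3B subrr zE.
move: (linear_predD lL (linear_predD lL Lu Lv) Lw).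
by rewrite !concat3D !addr0 !add0r -scalerDl addrC subrK; apply.
Qed.

End SymmetricDifference.

Unset Implicit Arguments.

Theorem proposition4p4 (R : realFieldType) (n : nat)
    (a : vec R (edge n)) (a0 : R) :
  (5 <= n)%N ->
  facet_ineq (@STSP R n) a a0 ->
  [/\ (* (a) *)
      facet_ineq (@TSD R n) (a ⊕ 0 ⊕ 0) a0 /\
      facet_ineq (@TSD R n) (0 ⊕ a ⊕ 0) a0,
      (* (b), with z_ij >= 0 written as - z_ij <= 0 *)
      (forall ij : edge n,
        facet_ineq (@TSD R n) (0 ⊕ 0 ⊕ (- unit_vec R ij)) 0 /\
        facet_ineq (@TSD R n) (0 ⊕ 0 ⊕ unit_vec R ij) 1)
    & (* (c) *)
      forall ij : edge n,
        facet_ineq (@TSD R n)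
          (unit_vec R ij ⊕ unit_vec R ij ⊕ (- unit_vec R ij)) 1].
Proof.
move=> n_gt4 /facet_conv_hull fa.
have [U dU] : exists U, direction_space (@tour_vec R n) U.
  by have [_ [d [/has_dimP [_ [U [dU _]]] _]]] := fa; exists U.
split; [split | move=> e; split | move=> e]; apply/facet_conv_hull.
- exact: (TSD_facet_fst n_gt4 dU).
- by apply: (TSD_facet_snd n_gt4 dU); apply: (TSD_facet_fst n_gt4 dU).
- exact: (TSD_facet_ge0 n_gt4 dU).
- exact: (TSD_facet_le1 n_gt4 dU).
exact: (TSD_facet_overlap n_gt4 dU).
Qed.
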